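(* For every quiver $G$, the quivers $G$ and $\tilde{\mathcal{R}}(G)$ (the partially reduced quiver of $G$) are locally strong $h$-homotopy equivalent.
   Context: A quiver $G=(V_G,E_G,s_G,t_G)$ consists of a non-empty set $V_G$ of vertices, a set $E_G$ of edges and functions $s_G,t_G\colon E_G\to V_G$. A quiver map $m\colon G\to G'$ is a pair $m_V\colon V_G\to V_{G'}$, $m_E\colon E_G\to E_{G'}\sqcup V_{G'}$ such that each edge $e$ is sent either to an edge with source $m_V(s(e))$ and target $m_V(t(e))$, or to the vertex $m_V(s(e))=m_V(t(e))$. A homomorphism is a quiver map sending edges to edges. A subquiver $H$ of $G$ has $V_H\subseteq V_G$, $E_H\subseteq E_G$ with restricted source and target; it is full if $E_H=\{e\in E_G\mid s_G(e),t_G(e)\in V_H\}$. A loop at $v$ is an edge with source and target $v$. An edge $e$ has a loop if there is a loop at $s(e)$ or at $t(e)$ (so a loop itself has a loop). The partially reduced quiver $\tilde{\mathcal{R}}(G)$ has vertex set $V_G$ and edges: every $e\in E_G$ that does not have a loop, with its source and target in $G$; and exactly one edge $\tilde{\mathcal{R}}(G,u,v)$ from $u$ to $v$ for each pair $u,v\in V_G$ such that there exists an edge $e\in E_G$ that has a loop with $s(e)=u$, $t(e)=v$. For a full subquiver $G'$ of $G$, the strong mapping cylinder $M^S_{G'\hookrightarrow G}$ is the quiver with vertices $(V_G\times\{0\})\cup(V_{G'}\times\{1\})$ and the following edges: $(e,0)$ for $e\in E_G$, from $(s(e),0)$ to $(t(e),0)$; $(e,1)$ for $e\in E_{G'}$,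 from $(s(e),1)$ to $(t(e),1)$; $(v,0\to1)$ for $v\in V_{G'}$, from $(v,0)$ to $(v,1)$; $(e,0\to1)$ for $e\in E_{G'}$, from $(s(e),0)$ to $(t(e),1)$; and $e_{e_G}$ for each $e_G\in E_G$ having exactly one of $s(e_G),t(e_G)$ in $V_{G'}$, whose source is $(s(e_G),1)$ if $s(e_G)\in V_{G'}$ and $(s(e_G),0)$ otherwise, and whose target is $(t(e_G),1)$ if $t(e_G)\in V_{G'}$ and $(t(e_G),0)$ otherwise. Define $i_0,i_1\colon G\to M^S_{G'\hookrightarrow G}$ by $i_0(v)=(v,0)$, $i_0(e)=(e,0)$; $i_1(v)=(v,1)$ if $v\in V_{G'}$ and $(v,0)$ otherwise; $i_1(e)=(e,1)$ if $e\in E_{G'}$, $i_1(e)=(e,0)$ if neither $s(e)$ nor $t(e)$ lies in $V_{G'}$, and $i_1(e)=e_e$ otherwise. Quiver maps $f_0,f_1\colon G_1\to G_2$ satisfy $f_0\simeq_1^{lSh}f_1$ if there are a full subquiver $G_1'$ of $G_1$ and a homomorphism $F\colon M^S_{G_1'\hookrightarrow G_1}\to G_2$ with $F\circ i_0=f_0$, $F\circ i_1=f_1$; $\simeq^{lSh}$ is the equivalence relation generated by $\simeq_1^{lSh}$. Quivers $G_1,G_2$ are locally strong $h$-homotopy equivalent if there are quiver maps $f\colon G_1\to G_2$, $h\colon G_2\to G_1$ with $h\circ f\simeq^{lSh}\mathrm{id}_{G_1}$ and $f\circ h\simeq^{lSh}\mathrm{id}_{G_2}$. The axiom of choice may be used.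 *)

(* Defs.v *)
From Stdlib Require Import Relation_Operators.
From mathcomp Require Import all_boot.
From mathcomp Require Import boolp classical_sets.

Set Implicit Arguments.
Unset Strict Implicit.
Unset Printing Implicit Defensive.

Local Open Scope classical_set_scope.

Record quiver := Quiver {
  vertex : Type;
  edge : Type;
  src : edge -> vertex;
  tgt : edge -> vertex;
  vertex_inhabited : inhabited vertex }.

Arguments src {q} e.
Arguments tgt {q} e.

(* An edge goes to an edge ([inl]) or is collapsed to a vertex ([inr]). *)
Record qmap (G G' : quiver) := QMap {
  vmap : vertex G -> vertex G';
  emap : edge G -> edge G' + vertex G';
  emapP : forall e, match emap e with
    | inl e' => src e' = vmap (src e) /\ tgt e' = vmap (tgt e)
    | inr v' => v' = vmap (src e) /\ v' = vmap (tgt e)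
    end }.

Definition homomorphism G G' (m : qmap G G') : Prop :=
  forall e, exists e', emap m e = inl e'.

Definition qid_emap (G : quiver) (e : edge G) : edge G + vertex G := inl e.

Lemma qid_emapP (G : quiver) (e : edge G) :
  match qid_emap e with
  | inl e' => src e' = src e /\ tgt e' = tgt e
  | inr v' => v' = src e /\ v' = tgt e
  end.
Proof. by []. Qed.

Definition qid (G : quiver) : qmap G G :=
  @QMap G G (fun v => v) (@qid_emap G) (@qid_emapP G).

Section Composition.
Variables (G1 G2 G3 : quiver) (g : qmap G2 G3) (f : qmap G1 G2).

Definition qcomp_vmap (v : vertex G1) : vertex G3 := vmap g (vmap f v).

Definition qcomp_emap (e : edge G1) : edge G3 + vertex G3 :=
  match emap f e with
  | inl e' => emap g e'
  | inr v' => inr (vmap g v')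
  end.

Lemma qcomp_emapP e :
  match qcomp_emap e with
  | inl e' => src e' = qcomp_vmap (src e) /\ tgt e' = qcomp_vmap (tgt e)
  | inr v' => v' = qcomp_vmap (src e) /\ v' = qcomp_vmap (tgt e)
  end.
Proof.
rewrite /qcomp_emap /qcomp_vmap; have := emapP f e.
case: (emap f e) => [e' [<- <-]|v' [<- <-]//].
exact: (emapP g e').
Qed.

Definition qcomp : qmap G1 G3 := QMap qcomp_emapP.

End Composition.

Record subquiver (G : quiver) := Subquiver {
  sub_vertex : set (vertex G);
  sub_edge : set (edge G);
  sub_vertex_nonempty : sub_vertex !=set0;
  sub_src : forall e, e \in sub_edge -> src e \in sub_vertex;
  sub_tgt : forall e, e \in sub_edge -> tgt e \in sub_vertex }.

Lemma subquiver_inhabited (G : quiver) (H : subquiver G) :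
  inhabited (set_type (sub_vertex H)).
Proof.
by case: (sub_vertex_nonempty H) => v vH; split; exists v; apply: mem_set.
Qed.

Definition quiver_of_subquiver (G : quiver) (H : subquiver G) : quiver :=
  @Quiver (set_type (sub_vertex H)) (set_type (sub_edge H))
    (fun e => exist _ (src (val e)) (sub_src (valP e)))
    (fun e => exist _ (tgt (val e)) (sub_tgt (valP e)))
    (subquiver_inhabited H).

Coercion quiver_of_subquiver : subquiver >-> quiver.

Definition full_subquiver (G : quiver) (H : subquiver G) : Prop :=
  sub_edge H = [set e | sub_vertex H (src e) /\ sub_vertex H (tgt e)].

Section StrongMappingCylinder.
Variables (G : quiver) (H : subquiver G).

Definition mixed_edge : set (edge G) :=
  [set e | (sub_vertex H (src e) /\ ~ sub_vertex H (tgt e)) \/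
           (~ sub_vertex H (src e) /\ sub_vertex H (tgt e))].

Inductive cyl_vertex :=
  | CylV0 of vertex G
  | CylV1 of vertex H.

Inductive cyl_edge :=
  | CylE0 of edge G
  | CylE1 of edge H
  | CylV01 of vertex H
  | CylE01 of edge H
  | CylMixed of set_type mixed_edge.

(* (v,1) if v is in H, and (v,0) otherwise. *)
Definition cyl_top (v : vertex G) : cyl_vertex :=
  if insub v is Some w then CylV1 w else CylV0 v.

Definition cyl_src (e : cyl_edge) : cyl_vertex :=
  match e with
  | CylE0 e => CylV0 (src e)
  | CylE1 e => CylV1 (src e)
  | CylV01 v => CylV0 (val v)
  | CylE01 e => CylV0 (src (val e))
  | CylMixed e => cyl_top (src (val e))
  end.

Definition cyl_tgt (e : cyl_edge) : cyl_vertex :=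
  match e with
  | CylE0 e => CylV0 (tgt e)
  | CylE1 e => CylV1 (tgt e)
  | CylV01 v => CylV1 v
  | CylE01 e => CylV1 (tgt e)
  | CylMixed e => cyl_top (tgt (val e))
  end.

Lemma cyl_inhabited : inhabited cyl_vertex.
Proof. by case: (vertex_inhabited G) => v; split; apply: CylV0. Qed.

Definition strong_cylinder : quiver := Quiver cyl_src cyl_tgt cyl_inhabited.

Definition cyl_in0_emap (e : edge G) :
  edge strong_cylinder + vertex strong_cylinder := inl (CylE0 e).

Lemma cyl_in0_emapP e :
  match cyl_in0_emap e with
  | inl e' => src e' = CylV0 (src e) /\ tgt e' = CylV0 (tgt e)
  | inr v' => v' = CylV0 (src e) /\ v' = CylV0 (tgt e)
  end.
Proof. by []. Qed.

Definition cyl_in0 : qmap G strong_cylinder :=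
  @QMap G strong_cylinder CylV0 cyl_in0_emap cyl_in0_emapP.

(* As [H] is full, an edge of [G] outside [H] that is not mixed has neither
   end in [H]. *)
Definition cyl_in1_emap (e : edge G) :
    edge strong_cylinder + vertex strong_cylinder :=
  inl (if insub e is Some e' then CylE1 e'
       else if insub e is Some e' then CylMixed e'
       else CylE0 e).

Hypothesis Hfull : full_subquiver H.

Lemma cyl_in1_emapP e :
  match cyl_in1_emap e with
  | inl e' => src e' = cyl_top (src e) /\ tgt e' = cyl_top (tgt e)
  | inr v' => v' = cyl_top (src e) /\ v' = cyl_top (tgt e)
  end.
Proof.
have top1 v (vH : v \in sub_vertex H) : cyl_top v = CylV1 (exist _ v vH).
  by rewrite /cyl_top (insubT (fun x => x \in sub_vertex H) vH).
have top0 v : ~ sub_vertex H v -> cyl_top v = CylV0 v.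
  by move=> vH; rewrite /cyl_top insubN //; apply/negP => /set_mem.
rewrite /cyl_in1_emap; case: insubP => [e' _ <-|/negP eH] /=.
  by rewrite (top1 _ (sub_src (valP e'))) (top1 _ (sub_tgt (valP e'))).
case: insubP => [e' _ <-//|/negP eM] /=.
have {}eH : ~ (sub_vertex H (src e) /\ sub_vertex H (tgt e)).
  by move=> ends; apply: eH; apply: mem_set; rewrite Hfull.
have {}eM : ~ mixed_edge e by move=> ?; apply: eM; apply: mem_set.
by rewrite !top0 // => ?; move: eH eM; rewrite /mixed_edge /=; tauto.
Qed.

Definition cyl_in1 : qmap G strong_cylinder :=
  @QMap G strong_cylinder cyl_top cyl_in1_emap cyl_in1_emapP.

End StrongMappingCylinder.

Definition lSh_step (G1 G2 : quiver) (f0 f1 : qmap G1 G2) : Prop :=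
  exists (H : subquiver G1) (Hfull : full_subquiver H)
         (F : qmap (strong_cylinder H) G2),
    [/\ homomorphism F,
        qcomp F (cyl_in0 H) = f0 &
        qcomp F (cyl_in1 Hfull) = f1].

Definition lSh_homotopic (G1 G2 : quiver) (f0 f1 : qmap G1 G2) : Prop :=
  clos_refl_sym_trans (qmap G1 G2) (@lSh_step G1 G2) f0 f1.

Definition lSh_equivalent (G1 G2 : quiver) : Prop :=
  exists (f : qmap G1 G2) (h : qmap G2 G1),
    lSh_homotopic (qcomp h f) (qid G1) /\ lSh_homotopic (qcomp f h) (qid G2).

Section PartiallyReduced.
Variable G : quiver.

Definition has_loop_at (v : vertex G) : Prop :=
  exists l : edge G, src l = v /\ tgt l = v.

Definition looped_edge : set (edge G) :=
  [set e | has_loop_at (src e) \/ has_loop_at (tgt e)].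

Definition looped_pair : set (vertex G * vertex G) :=
  [set uv | exists e : edge G,
     [/\ looped_edge e, src e = uv.1 & tgt e = uv.2]].

Inductive reduced_edge :=
  | KeptEdge of set_type (~` looped_edge)
  | MergedEdge of set_type looped_pair.

Definition reduced_src (e : reduced_edge) : vertex G :=
  match e with
  | KeptEdge e => src (val e)
  | MergedEdge uv => (val uv).1
  end.

Definition reduced_tgt (e : reduced_edge) : vertex G :=
  match e with
  | KeptEdge e => tgt (val e)
  | MergedEdge uv => (val uv).2
  end.

Definition partially_reduced : quiver :=
  Quiver reduced_src reduced_tgt (vertex_inhabited G).

End PartiallyReduced.

(* Main.v *)
(** Choosing one edge among parallel looped edges gives a section [h] of the
    quotient map [f : G -> partially_reduced G], so [f] after [h] is the
    identity, while [h] after [f] fixes the vertices and the edges without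
    loops, and moves any other edge to a parallel one.  These two self-maps of
    [G] are related by a single homotopy step, along the full subquiver on the
    vertices having a loop: the edges [(v,0) -> (v,1)] go to loops, and the
    cylinder imposes no relation between the images of the edges [(e,0)] and
    [(e,1)], or [(e,0)] and [e_e], apart from their ends. *)
Require Import Defs.
From Stdlib Require Import Relation_Operators.
From mathcomp Require Import all_boot.
From mathcomp Require Import boolp classical_sets.

Set Implicit Arguments.
Unset Strict Implicit.
Unset Printing Implicit Defensive.

Local Open Scope classical_set_scope.

(** [lSh_step] demands Leibniz equality of quiver maps; function extensionality handles the two
    maps, proof irrelevance the field [emapP]. *)
Lemma qmap_eq (G G' : quiver) (f g : qmap G G') :
  vmap f =1 vmap g -> emap f =1 emap g -> f = g.
Proof.
case: f g => [fv fe fP] [gv ge gP] /= /funext fgv /funext fge.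
by subst gv ge; congr QMap; apply: Prop_irrelevance.
Qed.

Section FullSubquiverOn.
Variables (G : quiver) (A : set (vertex G)) (A0 : A !=set0).

Let E : set (edge G) := [set e | A (src e) /\ A (tgt e)].

Let E_src e : e \in E -> src e \in A.
Proof. by move=> /set_mem[? _]; apply: mem_set. Qed.

Let E_tgt e : e \in E -> tgt e \in A.
Proof. by move=> /set_mem[_ ?]; apply: mem_set. Qed.

Definition full_subquiver_on : subquiver G := Subquiver A0 E_src E_tgt.

End FullSubquiverOn.

Section ParallelHomotopy.
Variables (G1 G2 : quiver) (f0 f1 : qmap G1 G2).
Hypotheses (f0_hom : homomorphism f0) (f1_hom : homomorphism f1).
Hypothesis eq_vmap : vmap f0 =1 vmap f1.

Section Step.
Variable H : subquiver G1.
Hypothesis Hfull : full_subquiver H.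
Variable loop : vertex H -> edge G2.
Hypothesis loopP :
  forall v, src (loop v) = vmap f0 (val v) /\ tgt (loop v) = vmap f0 (val v).
Hypothesis eq_emap : forall e, ~ sub_vertex H (src e) ->
  ~ sub_vertex H (tgt e) -> emap f0 e = emap f1 e.

Definition parallel_vmap (v : vertex (strong_cylinder H)) : vertex G2 :=
  match v with
  | CylV0 v => vmap f0 v
  | CylV1 v => vmap f0 (val v)
  end.

(** Neither [cyl_in0] nor [cyl_in1] takes the value [CylE01 e], so using [f0] there is a free
    choice: [f1] has the same ends. *)
Definition parallel_emap (e : edge (strong_cylinder H)) :
    edge G2 + vertex G2 :=
  match e with
  | CylE0 e => emap f0 e
  | CylE1 e => emap f1 (val e)
  | CylV01 v => inl (loop v)
  | CylE01 e => emap f0 (val e)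
  | CylMixed e => emap f1 (val e)
  end.

Lemma parallel_vmap_top v : parallel_vmap (cyl_top H v) = vmap f0 v.
Proof. by rewrite /cyl_top; case: insubP => [w _ <-|]. Qed.

Lemma parallel_emapP e :
  match parallel_emap e with
  | inl e' => src e' = parallel_vmap (src e) /\ tgt e' = parallel_vmap (tgt e)
  | inr v' => v' = parallel_vmap (src e) /\ v' = parallel_vmap (tgt e)
  end.
Proof.
case: e => [e|e|v|e|e] /=.
- exact: (emapP f0).
- by rewrite !eq_vmap; apply: (emapP f1).
- exact: loopP.
- exact: (emapP f0).
- by rewrite !parallel_vmap_top !eq_vmap; apply: (emapP f1).
Qed.

Definition parallel_homotopy : qmap (strong_cylinder H) G2 :=
  QMap parallel_emapP.

Lemma lSh_step_parallel : lSh_step f0 f1.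
Proof.
exists H, Hfull, parallel_homotopy; split.
- by case=> [e|e|v|e|e] /=; [| | exists (loop v) | |].
- exact: qmap_eq.
apply: qmap_eq => [v|e] /=; first by rewrite -eq_vmap; apply: parallel_vmap_top.
rewrite /qcomp_emap /=.
case: insubP => [e' _ <-//|/negP eH] /=.
case: insubP => [e' _ <-//|/negP eM] /=.
(* Here [cyl_in1] sends [e] to level 0, where the homotopy is [f0], although [f1] is wanted. By
   fullness, neither end of [e] is in [H], so [eq_emap] applies. *)
have {}eH : ~ (sub_vertex H (src e) /\ sub_vertex H (tgt e)).
  by move=> ends; apply: eH; apply: mem_set; rewrite Hfull.
have {}eM : ~ mixed_edge H e by move=> ?; apply: eM; apply: mem_set.
by apply: eq_emap => ?; move: eH eM; rewrite /mixed_edge /=; tauto.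
Qed.

End Step.

Lemma lSh_homotopic_parallel (A : set (vertex G1)) :
    (forall v, A v -> has_loop_at (vmap f0 v)) ->
    (forall e, ~ A (src e) -> ~ A (tgt e) -> emap f0 e = emap f1 e) ->
  lSh_homotopic f0 f1.
Proof.
(* A subquiver has a vertex, so an empty [A] gives no cylinder; but then [eqA] covers every edge and
   the two maps coincide. *)
move=> loopA eqA; have [A0|A0] := pselect (A !=set0); last first.
  have nA v : ~ A v by move=> Av; apply: A0; exists v.
  have -> : f0 = f1 by apply: qmap_eq => // e; apply: eqA.
  exact: rst_refl.
have /choice[loop loopP] : forall v : vertex (full_subquiver_on A0),
    exists l : edge G2, src l = vmap f0 (val v) /\ tgt l = vmap f0 (val v).
  by move=> v; apply: loopA; apply: set_mem; apply: (valP v).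
by apply: rst_step; apply: (lSh_step_parallel _ loopP).
Qed.

End ParallelHomotopy.

Section Reduction.
Variable G : quiver.

Lemma looped_pair_ends (e : edge G) :
  looped_edge e -> (src e, tgt e) \in @looped_pair G.
Proof. by move=> ?; apply: mem_set; exists e. Qed.

Definition reduce_edge (e : edge G) : reduced_edge G :=
  match pselect (looped_edge e) with
  | left eL => MergedEdge (exist _ (src e, tgt e) (looped_pair_ends eL))
  | right eL => KeptEdge (exist _ e (mem_set eL))
  end.

Lemma reduce_edgeP (e : edge G) :
  reduced_src (reduce_edge e) = src e /\ reduced_tgt (reduce_edge e) = tgt e.
Proof. by rewrite /reduce_edge; case: pselect. Qed.

Definition reduce : qmap G (partially_reduced G) :=
  @QMap G (partially_reduced G) id (fun e => inl (reduce_edge e)) reduce_edgeP.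

Definition lift_edge (e : reduced_edge G) : edge G :=
  match e with
  | KeptEdge e => val e
  | MergedEdge uv => projT1 (cid (set_mem (valP uv)))
  end.

Lemma lift_edgeP (e : reduced_edge G) :
  src (lift_edge e) = reduced_src e /\ tgt (lift_edge e) = reduced_tgt e.
Proof. by case: e => //= uv; case: cid => e []. Qed.

Definition lift : qmap (partially_reduced G) G :=
  @QMap (partially_reduced G) G id (fun e => inl (lift_edge e)) lift_edgeP.

(** The edge chosen for a merged pair is itself looped, with that pair as its ends, so reducing it
    gives the pair back; this also excludes the last case below. *)
Lemma lift_edgeK : cancel lift_edge reduce_edge.
Proof.
case=> [e|uv]; rewrite /reduce_edge /=; case: pselect => eL.
- by have /set_mem := valP e.
- by congr KeptEdge; apply: val_inj.
- congr MergedEdge; apply: val_inj => /=.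
  by case: cid => e /= [_ -> ->]; rewrite -surjective_pairing.
- by case: cid eL => e /= [].
Qed.

Lemma reduce_edgeK (e : edge G) :
  ~ looped_edge e -> lift_edge (reduce_edge e) = e.
Proof. by rewrite /reduce_edge; case: pselect. Qed.

End Reduction.

Theorem theorem6p1 (G : quiver) : lSh_equivalent G (partially_reduced G).
Proof.
exists (reduce G), (lift G); split.
  apply: (@lSh_homotopic_parallel _ _ _ _ _ _ _ (@has_loop_at G)) => //.
  - by move=> e; exists (lift_edge (reduce_edge e)).
  - by move=> e; exists e.
  (* Without a loop at either end, [e] is a kept edge, which [lift] returns unchanged. *)
  - by move=> e sL tL; congr inl; apply: reduce_edgeK; case.
have -> : qcomp (reduce G) (lift G) = qid (partially_reduced G).
  by apply: qmap_eq => // e; congr inl; apply: lift_edgeK.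
exact: rst_refl.
Qed.
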